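(* Let $\alpha\in(0,1)$, $\lambda\in(0,+\infty)^p$, $\mu\in(0,+\infty)^q$, and let $\widehat\Delta^{\lambda,\mu}_\alpha$ be the permuted test with Monte Carlo approximation based on $B$ random permutations. Then, for all $B$ and all densities $f_1$ on $\mathbb{R}^p$ and $f_2$ on $\mathbb{R}^q$, $$P_{f_1\otimes f_2}\big(\widehat\Delta^{\lambda,\mu}_\alpha=1\big)\le\alpha.$$
   Context: $p,q\ge1$ are fixed integers, $n\ge4$, and $\mathbb{Z}_n=(X_i,Y_i)_{1\le i\le n}$ is an i.i.d. sample in $\mathbb{R}^p\times\mathbb{R}^q$. $P_{f_1\otimes f_2}$ denotes the probability when the common density (with respect to Lebesgue measure) is $(f_1\otimes f_2)(x,y)=f_1(x)f_2(y)$ (and also includes the randomness of the permutations below). For $\lambda\in(0,\infty)^p$, $\mu\in(0,\infty)^q$ put $\varphi_\lambda(x)=\prod_{i=1}^p\frac{1}{\sqrt{2\pi}\lambda_i}e^{-x_i^2/(2\lambda_i^2)}$, $\phi_\mu(y)=\prod_{j=1}^q\frac{1}{\sqrt{2\pi}\mu_j}e^{-y_j^2/(2\mu_j^2)}$, $k_\lambda(x,x')=\varphi_\lambda(x-x')$, $l_\mu(y,y')=\phi_\mu(y-y')$. With $\mathbf{i}^n_r$ the set of $r$-tuples of pairwise distinct elements of $\{1,\dots,n\}$, $$\widehat{\mathrm{HSIC}}_{\lambda,\mu}(\mathbb{Z}_n)=\frac{\sum_{(i,j)\in\mathbf{i}^n_2}k_\lambda(X_i,X_j)l_\mu(Y_i,Y_j)}{n(n-1)}+\frac{\sum_{(i,j,r,s)\in\mathbf{i}^n_4}k_\lambda(X_i,X_j)l_\mu(Y_r,Y_s)}{n(n-1)(n-2)(n-3)}-2\,\frac{\sum_{(i,j,r)\in\mathbf{i}^n_3}k_\lambda(X_i,X_j)l_\mu(Y_j,Y_r)}{n(n-1)(n-2)}.$$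 Permuted test. Let $\tau_1,\dots,\tau_B$ be i.i.d. uniform random permutations of $\{1,\dots,n\}$, independent of $\mathbb{Z}_n$, and $\mathbb{Z}_n^{\tau_b}=(X_i,Y_{\tau_b(i)})_{1\le i\le n}$. Set $\widehat H^{\star b}=\widehat{\mathrm{HSIC}}_{\lambda,\mu}(\mathbb{Z}_n^{\tau_b})$ for $1\le b\le B$ and $\widehat H^{\star B+1}=\widehat{\mathrm{HSIC}}_{\lambda,\mu}(\mathbb{Z}_n)$, and let $\widehat H^{\star(1)}\le\dots\le\widehat H^{\star(B+1)}$ be the order statistics of these $B+1$ values. Put $\hat q^{\lambda,\mu}_{1-\alpha}=\widehat H^{\star(\lceil(B+1)(1-\alpha)\rceil)}$, and let $\widehat\Delta^{\lambda,\mu}_\alpha=1$ if $\widehat{\mathrm{HSIC}}_{\lambda,\mu}(\mathbb{Z}_n)>\hat q^{\lambda,\mu}_{1-\alpha}$ and $0$ otherwise. *)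

(* Defs.v *)
From HB Require Import structures.
From mathcomp Require Import all_boot all_order all_algebra perm.
From mathcomp Require Import all_classical all_reals all_analysis.

Set Implicit Arguments.
Unset Strict Implicit.
Unset Printing Implicit Defensive.

Import Order.TTheory GRing.Theory Num.Theory.
Import numFieldNormedType.Exports.

Local Open Scope classical_set_scope.
Local Open Scope ring_scope.

(* R^p is p.-tuple R: MathComp-Analysis equips tuples (and not 'rV[R]_p) with
   the product sigma-algebra, which on R^p is the Borel one. *)

Section tuple_cons.
Context {R : realType} {p : nat}.

Definition tuple_cons (x : R * p.-tuple R) : p.+1.-tuple R :=
  [the p.+1.-tuple R of x.1 :: x.2].

Definition tuple_uncons (t : p.+1.-tuple R) : R * p.-tuple R :=
  (thead t, [tuple of behead t]).

Lemma measurable_tuple_cons : measurable_fun setT tuple_cons.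
Proof. exact: measurable_cons. Qed.

Lemma measurable_tuple_uncons : measurable_fun setT tuple_uncons.
Proof.
by apply/measurable_fun_pair; [exact: measurable_tnth|exact: measurable_behead].
Qed.

Lemma tuple_consK : cancel tuple_cons tuple_uncons.
Proof. by case=> x t; congr pair; apply/val_inj. Qed.

Lemma tuple_unconsK : cancel tuple_uncons tuple_cons.
Proof. by move=> t; rewrite [RHS]tuple_eta; apply/val_inj. Qed.

End tuple_cons.

Definition lebesgue_cons {R : realType} p (m : set (p.-tuple R) -> \bar R) :
    set (p.+1.-tuple R) -> \bar R :=
  pushforward (lebesgue_measure \x m)%E tuple_cons.

Section lebesgue_cons.
Local Open Scope ereal_scope.
Context {R : realType} (p : nat).
Variable m : {sigma_finite_measure set (p.-tuple R) -> \bar R}.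

Let lc0 : lebesgue_cons m set0 = 0.
Proof. by rewrite /lebesgue_cons /pushforward preimage_set0 measure0. Qed.

Let lc_ge0 A : 0 <= lebesgue_cons m A.
Proof. by rewrite /lebesgue_cons /pushforward measure_ge0. Qed.

Let lc_sigma_additive : semi_sigma_additive (lebesgue_cons m).
Proof.
move=> F mF tF mUF; rewrite /lebesgue_cons /pushforward preimage_bigcup.
have mP A : measurable A -> measurable (@tuple_cons R p @^-1` A).
  by move=> mA; rewrite -[X in measurable X]setTI; exact: measurable_tuple_cons.
apply: measure_semi_sigma_additive.
- by move=> n; exact: mP.
- apply/trivIsetP => /= i j _ _ ij; rewrite -preimage_setI.
  by move/trivIsetP : tF => /(_ _ _ _ _ ij) ->//; rewrite preimage_set0.
- by rewrite -preimage_bigcup; exact: mP.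
Qed.

HB.instance Definition _ := isMeasure.Build _ _ _ (lebesgue_cons m)
  lc0 lc_ge0 lc_sigma_additive.

Let lc_sigma_finite : sigma_finite setT (lebesgue_cons m).
Proof.
have /sigma_finiteP[F [UF ndF mF]] := sigma_finiteT (@lebesgue_measure R).
have /sigma_finiteP[G [UG ndG mG]] := sigma_finiteT m.
exists (fun k => @tuple_uncons R p @^-1` (F k `*` G k)).
  rewrite -preimage_bigcup (_ : \bigcup_k _ = setT) ?preimage_setT//.
  apply/seteqP; split => // -[x y] _.
  have [i _ Fx] : (\bigcup_k F k) x by rewrite -UF.
  have [j _ Gy] : (\bigcup_k G k) y by rewrite -UG.
  exists (maxn i j) => //; split => /=.
  - by move: x Fx; exact/subsetPset/ndF/leq_maxl.
  - by move: y Gy; exact/subsetPset/ndG/leq_maxr.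
move=> k; have [mFk Fk] := mF k; have [mGk Gk] := mG k; split.
  rewrite -[X in measurable X]setTI; apply: measurable_tuple_uncons => //.
  exact: measurableX.
rewrite /lebesgue_cons /pushforward -comp_preimage.
rewrite (_ : _ \o _ = id) ?preimage_id; last first.
  by apply/funext => x; exact: tuple_consK.
by rewrite product_measure1E// lte_mul_pinfty// ge0_fin_numE.
Qed.

HB.instance Definition _ := Measure_isSigmaFinite.Build _ _ _ (lebesgue_cons m)
  lc_sigma_finite.

End lebesgue_cons.

Fixpoint lebesgue_tuple {R : realType} (p : nat) : set (p.-tuple R) -> \bar R :=
  if p is p'.+1 then lebesgue_cons (lebesgue_tuple (p := p'))
  else dirac ([tuple] : 0.-tuple R).
Arguments lebesgue_tuple {R} p.

Section lebesgue_tuple.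
Local Open Scope ereal_scope.
Context {R : realType} (p : nat).
Notation lebesgue_p := (@lebesgue_tuple R p).

Lemma lebesgue_tuple_sigma_finite_measure q :
  exists m : {sigma_finite_measure set (q.-tuple R) -> \bar R},
    @lebesgue_tuple R q = m.
Proof.
elim: q => [|q [m mE]].
  by exists (dirac ([tuple] : 0.-tuple R)).
by exists (lebesgue_cons m); rewrite /= mE.
Qed.

Let lt0 : lebesgue_p set0 = 0.
Proof.
by have [m ->] := lebesgue_tuple_sigma_finite_measure p; rewrite measure0.
Qed.

Let lt_ge0 A : 0 <= lebesgue_p A.
Proof.
by have [m ->] := lebesgue_tuple_sigma_finite_measure p; exact: measure_ge0.
Qed.

Let lt_sigma_additive : semi_sigma_additive lebesgue_p.
Proof.
have [m ->] := lebesgue_tuple_sigma_finite_measure p.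
exact: measure_semi_sigma_additive.
Qed.

HB.instance Definition _ := isMeasure.Build _ _ _ lebesgue_p
  lt0 lt_ge0 lt_sigma_additive.

Let lt_sigma_finite : sigma_finite setT lebesgue_p.
Proof.
by have [m ->] := lebesgue_tuple_sigma_finite_measure p; exact: sigma_finiteT.
Qed.

HB.instance Definition _ := Measure_isSigmaFinite.Build _ _ _ lebesgue_p
  lt_sigma_finite.

End lebesgue_tuple.

Lemma lebesgue_tuple_box {R : realType} p (A : 'I_p -> set R) :
  (forall i, measurable (A i)) ->
  lebesgue_tuple p [set t : p.-tuple R | forall i, A i (tnth t i)] =
  (\prod_(i < p) (lebesgue_measure : set R -> \bar R) (A i))%E.
Proof.
elim: p A => [|p IH] A mA.
  by rewrite big_ord0 /= diracE mem_set// => -[].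
rewrite big_ord_recl/= /lebesgue_cons /pushforward.
set B := [set t : p.-tuple R | forall i, A (lift ord0 i) (tnth t i)].
have mB : measurable B.
  rewrite (_ : B = \bigcap_(i in [set: 'I_p])
      ((fun t => tnth t i) @^-1` A (lift ord0 i))); last first.
    by apply/seteqP; split => [t Bt i _|t Bt i]; exact: Bt.
  apply: fin_bigcap_measurable; first exact: finite_finset.
  by move=> i _; rewrite -[X in measurable X]setTI; exact: measurable_tnth.
rewrite (_ : _ @^-1` _ = A ord0 `*` B); last first.
  apply/seteqP; split => [[x t] h|[x t] [/= Ax Bt] i].
    split; first exact: (h ord0).
    by move=> i; have := h (lift ord0 i); rewrite tnthS.
  case: (unliftP ord0 i) => [j|] ->; last by [].
  by rewrite tnthS; exact: Bt.
rewrite product_measure1E; [congr (_ * _)%E|exact: mA|exact: mB].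
by apply: (IH (fun i => A (lift ord0 i))) => i; exact: mA.
Qed.

Section random_elements.
Context d (T : measurableType d) (R : realType) (P : probability T R).

Definition mutually_independent (I : finType) d' (U : measurableType d')
    (X : I -> T -> U) : Prop :=
  forall (J : {set I}) (A : I -> set U),
    (forall i, i \in J -> measurable (A i)) ->
    P (\bigcap_(i in [set` J]) X i @^-1` A i) =
    (\prod_(i in J) P (X i @^-1` A i))%E.

Definition independent d1 (U1 : measurableType d1) d2 (U2 : measurableType d2)
    (X : T -> U1) (Y : T -> U2) : Prop :=
  forall (A : set U1) (B : set U2), measurable A -> measurable B ->
    P (X @^-1` A `&` Y @^-1` B) = (P (X @^-1` A) * P (Y @^-1` B))%E.

Definition has_density d' (U : measurableType d') (mu : set U -> \bar R)
    (f : U -> R) (X : {RV P >-> U}) : Prop :=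
  forall A : set U, measurable A ->
    distribution P X A = (\int[mu]_(x in A) (f x)%:E)%E.

End random_elements.

Definition joint (T U : Type) n (X : 'I_n -> T -> U) (w : T) : n.-tuple U :=
  [tuple X i w | i < n].

Definition is_density d (U : measurableType d) (R : realType)
    (mu : set U -> \bar R) (f : U -> R) : Prop :=
  [/\ measurable_fun setT f, (forall x, 0 <= f x) &
      (\int[mu]_x (f x)%:E)%E = 1%E].

Definition tensor (R : realType) (U V : Type) (f1 : U -> R) (f2 : V -> R)
    (z : U * V) : R := f1 z.1 * f2 z.2.

HB.instance Definition _ (I : finType) :=
  isPointed.Build (perm_type I) (1%g : {perm I}).
HB.instance Definition _ (I : finType) :=
  @isMeasurable.Build default_measure_display (perm_type I)
    discrete_measurable discrete_measurable0
    discrete_measurableC discrete_measurableU.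

Definition uniform_perm d (T : measurableType d) (R : realType)
    (P : probability T R) n (tau : {RV P >-> 'S_n}) : Prop :=
  forall s : 'S_n, P (tau @^-1` [set s]) = ((n`!)%:R^-1)%:E.

Section hsic.
Context {R : realType} {p q n : nat}.
Implicit Types (lam : p.-tuple R) (mu : q.-tuple R).
Implicit Types z : 'I_n -> p.-tuple R * q.-tuple R.

Definition gauss m (lam x : m.-tuple R) : R :=
  \prod_(i < m) ((Num.sqrt (2 * pi) * tnth lam i)^-1 *
                 expR (- (tnth x i ^+ 2 / (2 * tnth lam i ^+ 2)))).

Definition gauss_kernel m (lam x x' : m.-tuple R) : R :=
  gauss lam [tuple tnth x i - tnth x' i | i < m].

Definition hsic lam mu z : R :=
  let k i j := gauss_kernel lam (z i).1 (z j).1 in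
  let l i j := gauss_kernel mu (z i).2 (z j).2 in
  let N : R := n%:R in
  (\sum_(i < n) \sum_(j < n | uniq [:: i; j]) k i j * l i j)
    / (N * (N - 1))
  + (\sum_(i < n) \sum_(j < n) \sum_(r < n) \sum_(s < n | uniq [:: i; j; r; s])
       k i j * l r s)
    / (N * (N - 1) * (N - 2) * (N - 3))
  - 2 * ((\sum_(i < n) \sum_(j < n) \sum_(r < n | uniq [:: i; j; r])
            k i j * l j r)
         / (N * (N - 1) * (N - 2))).

Definition permute_sample z (s : 'S_n) : 'I_n -> p.-tuple R * q.-tuple R :=
  fun i => ((z i).1, (z (s i)).2).

Definition hsic_values lam mu B (tau : 'I_B -> 'S_n) z : seq R :=
  rcons [seq hsic lam mu (permute_sample z (tau b)) | b <- enum 'I_B]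
        (hsic lam mu z).

End hsic.

(* k-th smallest entry of s, counted from 1: meaningful for 1 <= k <= size s *)
Definition order_stat (R : realType) (s : seq R) (k : nat) : R :=
  nth 0 (sort <=%R s) k.-1.

Section permuted_test.
Context {R : realType} {p q n : nat}.

Definition perm_quantile (alpha : R) (lam : p.-tuple R) (mu : q.-tuple R)
    B (tau : 'I_B -> 'S_n) (z : 'I_n -> p.-tuple R * q.-tuple R) : R :=
  order_stat (hsic_values lam mu tau z)
    `|Num.ceil (B.+1%:R * (1 - alpha))|%N.

Definition perm_test (alpha : R) (lam : p.-tuple R) (mu : q.-tuple R)
    B (tau : 'I_B -> 'S_n) (z : 'I_n -> p.-tuple R * q.-tuple R) : nat :=
  if perm_quantile alpha lam mu tau z < hsic lam mu z then 1 else 0.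

End permuted_test.

(* Main.v *)
Require Import Defs.
From HB Require Import structures.
From mathcomp Require Import all_boot all_order all_algebra fingroup perm.
From mathcomp Require Import all_classical all_reals all_analysis.
From mathcomp Require Import measurable_realfun.

(** Under the null hypothesis the two coordinates of each observation are
    independent, so the law nu of the sample Z is invariant under permuting
    the Y-coordinates alone.  The densities enter only through this fact: on a
    rectangle prod_i (A_i x C_i) the law is a product of integrals of f1 over
    the A_i and of f2 over the C_i, a permutation only reorders the C_i, and
    such rectangles form a pi-system generating the sigma-algebra
    ([probability_permute_tuple], [iid_tensor_permute]).

    Let k = ceil((B+1)(1-alpha)).  The test rejects exactly when at least k of
    the B+1 values H_1, ..., H_B, H_(B+1) are strictly below the last one,
    the one of the unpermuted sample ([perm_test_eq1]).  This reformulation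
    removes order statistics: it makes the rejection event visibly measurable,
    makes sense for any of the B+1 positions, and shows that, for any values
    whatsoever, at most B+1-k <= alpha(B+1) positions reject
    ([card_num_below_ge]).

    It remains to see that every position rejects with the same probability.
    Since tau is uniform on (S_n)^B and independent of Z, the probability of
    rejection is the average over t in (S_n)^B of the nu-measure of the
    rejection region for the permutations t_1, ..., t_B, 1.  By invariance of
    nu, these may be replaced with t_1 s, ..., t_B s, s for any s
    ([reject_translate]); averaging over s as well, (t_1 s, ..., t_B s, s)
    runs over all of (S_n)^(B+1), where no position is privileged
    ([sum_reject_exchangeable]).  Summing over the B+1 positions gives
    (B+1) P(rejection) <= B+1-k, hence the bound ([randomization_bound],
    [permutation_test_level]). *)

Set Implicit Arguments.
Unset Strict Implicit.
Unset Printing Implicit Defensive.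

Import Order.TTheory GRing.Theory Num.Theory.
Import numFieldNormedType.Exports.

Local Open Scope classical_set_scope.
Local Open Scope ring_scope.

(** * Ranks and order statistics *)

Definition num_below d (O : orderType d) (I : finType) (h : I -> O) (j : I) :
    nat :=
  #|[pred i | (h i < h j)%O]|.

(** Let h j1 be minimal among the values that have at least k values strictly
    below them: by minimality, none of the values below h j1 has this
    property. *)
Lemma card_num_below_ge d (O : orderType d) (I : finType) (h : I -> O)
    (k : nat) :
  (#|[pred j | k <= num_below h j]| <= #|I| - k)%N.
Proof.
set rej := [pred j | _].
case: (pickP rej) => [j0 rej0|rej0]; last by rewrite eq_card0.
have [j1 rej1 j1min] := arg_minP h rej0.
have /subset_leq_card : rej \subset [predC [pred i | (h i < h j1)%O]].
  by apply/fintype.subsetP => j /j1min; rewrite !inE -leNgt.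
move=> /leq_trans; apply.
rewrite -[#|I|](cardC [pred i | (h i < h j1)%O]).
by rewrite leq_subRL ?leq_add2r// (leq_trans rej1) ?leq_addr.
Qed.

Lemma order_stat_lt (R : realType) (s : seq R) (k : nat) (x : R) :
  (0 < k <= size s)%N ->
  (order_stat s k < x) = (k <= count (< x)%R s)%N.
Proof.
case: k => // k /= ks; rewrite /order_stat /=.
have sorted_s : sorted <=%R (sort <=%R s) by exact: sort_le_sorted.
have -> : count (< x) s = count (< x) (sort <=%R s).
  by apply/seq.permP; rewrite perm_sym perm_sort.
apply/idP/idP => [|kc]; last exact: nth_count_lt.
apply: contraTT; rewrite -leqNgt -leNgt => kc.
by apply: nth_count_ge; rewrite // size_sort; apply/andP; split.
Qed.

Lemma num_below_perm d (O : orderType d) (I : finType) (h : I -> O)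
    (s : {perm I}) j :
  num_below (h \o s) j = num_below h (s j).
Proof.
rewrite /num_below -(fintype.card_image (@perm_inj _ s)); apply: eq_card => i.
rewrite !inE /=; apply/fintype.imageP/idP => [[x /= xj ->]//|ij].
by exists (s^-1%g i); rewrite ?inE /= permKV.
Qed.

Lemma num_belowE d (O : orderType d) (I : finType) (h : I -> O) (j : I) :
  num_below h j = (\sum_(i : I) (h i < h j)%O)%N.
Proof.
rewrite /num_below -sum1_card big_mkcond; apply: eq_bigr => i _.
by rewrite inE; case: ifP.
Qed.

(** * Randomization tests for an invariant probability measure *)

Section randomization.
Context d (T : measurableType d) (R : realType) (nu : probability T R).
Context (G : finGroupType) (act : G -> T -> T) (H : T -> R).
Hypothesis actM : forall s t z, act t (act s z) = act (t * s)%g z.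
Hypothesis measurable_act : forall s, measurable_fun setT (act s).
Hypothesis act_invariant :
  forall s A, measurable A -> nu (act s @^-1` A) = nu A.
Hypothesis measurable_H : measurable_fun setT H.

(** The rejection region of the randomization test in which the position j, and
    not only the one of the observed sample, plays the role of the data. *)
Definition reject (I : finType) (k : nat) (u : I -> G) (j : I) : set T :=
  [set z | (k <= num_below (fun i => H (act (u i) z)) j)%N].

Lemma measurable_reject (I : finType) k (u : I -> G) j :
  measurable (reject k u j).
Proof.
have mHu i : measurable_fun setT (fun z => H (act (u i) z)).
  exact: measurableT_comp.
pose below z : R := \sum_(i : I) (H (act (u i) z) < H (act (u j) z))%R%:R.
have mbelow : measurable_fun setT below.
  apply: measurable_sum => i.
  apply: (@measurableT_comp _ _ _ _ _ _ (fun b : bool => b%:R : R)) => //.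
  exact: measurable_fun_ltr.
have -> : reject k u j = (fun z => k%:R <= below z) @^-1` [set true].
  by apply/seteqP; split=> z /=;
    rewrite /reject /= /below -natr_sum ler_nat num_belowE.
rewrite -[X in measurable X]setTI.
exact: measurable_fun_ler.
Qed.

(** Integrate the pointwise bound [card_num_below_ge]. *)
Lemma sum_reject_index_le (I : finType) k (u : I -> G) :
  \sum_(j : I) fine (nu (reject k u j)) <= (#|I| - k)%:R.
Proof.
have nuE j : (fine (nu (reject k u j)))%:E =
    (\int[nu]_x (\1_(reject k u j) x)%:E)%E.
  have mr := measurable_reject k u j.
  by rewrite integral_indic// setIT fineK// fin_num_measure.
rewrite -lee_fin -sumEFin (eq_bigr _ (fun j _ => nuE j)).
rewrite -ge0_integral_sum //; last first.
  by move=> j; apply/measurable_EFinP/measurable_indic/measurable_reject.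
apply: (@le_trans _ _ (\int[nu]_x (#|I| - k)%:R%:E)%E); last first.
  by rewrite integral_cst// [X in (_ * X)%E]probability_setT mule1.
apply: ge0_le_integral => //.
- by move=> x _; apply: sume_ge0 => j _; rewrite lee_fin.
- apply: emeasurable_sum => j.
  by apply/measurable_EFinP/measurable_indic/measurable_reject.
- move=> x _; rewrite sumEFin lee_fin.
  pose h i := H (act (u i) x).
  apply: (@le_trans _ _ #|[pred j | (k <= num_below h j)%N]|%:R).
    rewrite -sum1_card natr_sum [leRHS]big_mkcond; apply: ler_sum => j _.
    rewrite indicE inE /=; case: ifPn; rewrite /reject /= => kh.
      by rewrite mem_set.
    by rewrite memNset //; apply/negP.
  by rewrite ler_nat card_num_below_ge.
Qed.

(** Reindex the sum by the exchange of the coordinates i and j of u. *)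
Lemma sum_reject_exchangeable (I : finType) k (i j : I) :
  \sum_(u : {ffun I -> G}) fine (nu (reject k u i)) =
  \sum_(u : {ffun I -> G}) fine (nu (reject k u j)).
Proof.
pose swap (u : {ffun I -> G}) := [ffun x => u (tperm i j x)].
have swapK : involutive swap.
  by move=> u; apply/ffunP => x; rewrite !ffunE tpermK.
rewrite (reindex_inj (inv_inj swapK)) /=; apply: eq_bigr => u _.
congr (fine (nu _)); apply/funext => z; rewrite /reject /mkset.
congr (is_true (_ <= _)%N).
rewrite -[j in RHS](tpermL i j) -(num_below_perm (fun x => H (act (u x) z))).
by apply: eq_card => x; rewrite !inE /= !ffunE.
Qed.

Lemma sum_reject_le (I : finType) k (j : I) :
  #|I|%:R * \sum_(u : {ffun I -> G}) fine (nu (reject k u j)) <=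
  (#|I| - k)%:R * (#|G| ^ #|I|)%:R.
Proof.
rewrite mulr_natl -sumr_const.
rewrite (eq_bigr (fun i => \sum_(u : {ffun I -> G}) fine (nu (reject k u i))));
  last first.
  by move=> i _; exact: sum_reject_exchangeable.
rewrite exchange_big /= -card_ffun mulr_natr -sumr_const.
by apply: ler_sum => u _; exact: sum_reject_index_le.
Qed.

(** Moving z by s turns each t_b z into (t_b s) z, and z itself into s z. *)
Lemma reject_translate (J : finType) k (t : J -> G) (s : G) :
  nu (reject k (oapp t 1%g) None) =
  nu (reject k (oapp (fun b => t b * s)%g s) None).
Proof.
rewrite -(act_invariant s (measurable_reject _ _ _)); congr (nu _).
apply/funext => z; rewrite /reject /mkset /preimage /=.
congr (is_true (_ <= _)%N).
by apply: eq_card => -[b|]; rewrite !inE /= !actM ?mul1g.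
Qed.

(** The index [None] stands for the unmoved sample, the indices [Some b] for the
    randomly moved ones. *)
Lemma randomization_bound (J : finType) k :
  #|J|.+1%:R *
    \sum_(t : {ffun J -> G}) fine (nu (reject k (oapp t 1%g) None)) <=
  (#|J|.+1 - k)%:R * (#|G| ^ #|J|)%:R.
Proof.
have G0 : 0 < #|G|%:R :> R by rewrite ltr0n; apply/card_gt0P; exists 1%g.
(* an extra factor #|G| makes room for the average over s *)
rewrite -(ler_pM2r G0) -[leRHS]mulrA -natrM -expnSr -card_option.
apply: le_trans (sum_reject_le k None).
rewrite -mulrA ler_pM2l ?ltr0n ?card_option// mulrC mulr_natl -sumr_const.
rewrite (eq_bigr (fun s : G => \sum_(t : {ffun J -> G})
   fine (nu (reject k (oapp (fun b => t b * s)%g s) None)))); last first.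
  by move=> s _; apply: eq_bigr => t _; rewrite (reject_translate k t s).
rewrite pair_big /=.
pose ext (st : G * {ffun J -> G}) : {ffun option J -> G} :=
  [ffun o => oapp (fun b => st.2 b * st.1)%g st.1 o].
pose split (u : {ffun option J -> G}) : G * {ffun J -> G} :=
  (u None, [ffun b => u (Some b) * (u None)^-1]%g).
have extK : cancel ext split.
  move=> [s t]; rewrite /split /ext !ffunE /=; congr pair.
  by apply/ffunP => b; rewrite !ffunE /= mulgK.
have splitK : cancel split ext.
  by move=> u; apply/ffunP => -[b|]; rewrite !ffunE //= ffunE mulgKV.
rewrite [leRHS](reindex ext) /=; last by exists split => ? _.
rewrite le_eqVlt; apply/orP; left; apply/eqP; apply: eq_bigr => -[s t] _.
congr (fine (nu _)); apply/funext => z; rewrite /reject /mkset.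
by congr (is_true (_ <= _)%N); apply: eq_card => o; rewrite !inE !ffunE.
Qed.

End randomization.

(** * Invariance of the sample law under permutation of one coordinate *)

Lemma measurable_tuple_box d (U : measurableType d) n (A : 'I_n -> set U) :
  (forall i, measurable (A i)) ->
  measurable [set z : n.-tuple U | forall i, A i (tnth z i)].
Proof.
move=> mA.
have -> : [set z : n.-tuple U | forall i, A i (tnth z i)] =
    \bigcap_(i in [set: 'I_n]) ((fun z => tnth z i) @^-1` A i).
  by apply/seteqP; split=> [z h i _|z h i]; exact: h.
apply: fin_bigcap_measurable => [|i _]; first exact: finite_finset.
by rewrite -[X in measurable X]setTI; exact: measurable_tnth.
Qed.

Lemma set1_tuple_box (U : Type) n (t : n.-tuple U) :
  [set t] = [set z | forall i, [set tnth t i] (tnth z i)].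
Proof.
by apply/seteqP; split=> [z ->//|z tz]; apply: eq_from_tnth => i; exact: tz.
Qed.

Section permutation_of_sample.
Context {U V : Type} {n : nat}.

Definition permute_tuple (s : 'S_n) (z : n.-tuple (U * V)) : n.-tuple (U * V) :=
  [tuple ((tnth z i).1, (tnth z (s i)).2) | i < n].

(** Permutations compose from left to right, i.e., (t * s) i = s (t i). *)
Lemma permute_tupleM s t z :
  permute_tuple t (permute_tuple s z) = permute_tuple (t * s)%g z.
Proof. by apply: eq_from_tnth => i; rewrite !tnth_mktuple permM. Qed.

Definition pair_rect (A : 'I_n -> set U) (C : 'I_n -> set V) :
    set (n.-tuple (U * V)) :=
  [set z | forall i, (A i `*` C i) (tnth z i)].

Lemma preimage_permute_rect s A C :
  permute_tuple s @^-1` pair_rect A C = pair_rect A (C \o s^-1%g).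
Proof.
apply/seteqP; split=> z /= zAC i.
  split; first by have [] := zAC i; rewrite tnth_mktuple.
  by have [_] := zAC (s^-1 i)%g; rewrite tnth_mktuple /= permKV.
rewrite tnth_mktuple; split; first by have [] := zAC i.
by have [_] := zAC (s i); rewrite /= permK.
Qed.

End permutation_of_sample.

Section pair_rect_measurable.
Context d1 d2 (U : measurableType d1) (V : measurableType d2) (n : nat).

Definition pair_rects : set (set (n.-tuple (U * V))) :=
  [set D | exists A C, [/\ forall i, measurable (A i),
    forall i, measurable (C i) & D = pair_rect A C]].

Lemma pair_rects_setI : setI_closed pair_rects.
Proof.
move=> _ _ [A1 [C1 [mA1 mC1 ->]]] [A2 [C2 [mA2 mC2 ->]]].
exists (fun i => A1 i `&` A2 i), (fun i => C1 i `&` C2 i).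
split=> [i|i|]; [exact: measurableI|exact: measurableI|].
apply/seteqP; split=> z /=.
  by move=> [z1 z2] i; have [? ?] := z1 i; have [? ?] := z2 i.
by move=> z12; split=> i; have [[? ?] [? ?]] := z12 i.
Qed.

Lemma measurable_pair_rect A C :
  (forall i, measurable (A i)) -> (forall i, measurable (C i)) ->
  measurable (@pair_rect U V n A C).
Proof.
move=> mA mC; apply: (measurable_tuple_box (A := fun i => A i `*` C i)) => i.
exact: measurableX.
Qed.

(** The only non-trivial inclusion holds because both components of each
    coordinate map are measurable for the sigma-algebra generated by the
    rectangles: their preimages are rectangles with a single proper side. *)
Lemma measurable_pair_rectsE :
  (@measurable _ (n.-tuple (U * V)%type)) = <<s pair_rects >>.
Proof.
apply/seteqP; split; last first.
  apply: smallest_sub; first exact: sigma_algebra_measurable.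
  by move=> _ [A [C [mA mC ->]]]; exact: measurable_pair_rect.
pose S := g_sigma_algebraType pair_rects.
have mtnth i :
    measurable_fun [set: S] (fun z : S => tnth (z : n.-tuple (U * V)) i).
  apply/measurable_fun_pairP; split => /= _ A mA;
    rewrite setTI; apply: sub_sigma_algebra.
  - exists (fun j => if j == i then A else setT), (fun=> setT).
    split=> [j|//|]; first by case: ifP.
    apply/seteqP; split=> z /=; last by move=> /(_ i)[]; rewrite eqxx.
    by move=> Az j; split=> //=; case: eqP => // ->.
  - exists (fun=> setT), (fun j => if j == i then A else setT).
    split=> [//|j|]; first by case: ifP.
    apply/seteqP; split=> z /=; last by move=> /(_ i)[]; rewrite eqxx.
    by move=> Az j; split=> //=; case: eqP => // ->.
have mid : measurable_fun [set: S] (fun z : S => (z : n.-tuple (U * V))).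
  by apply/measurable_fun_tnthP.
by move=> A mA; have := mid measurableT A mA; rewrite setTI.
Qed.

Lemma measurable_permute_tuple (s : 'S_n) :
  measurable_fun setT (@permute_tuple U V n s).
Proof.
apply/measurable_fun_tnthP => i.
rewrite (_ : _ \o _ = fun z => ((tnth z i).1, (tnth z (s i)).2)); last first.
  by apply/funext => z; rewrite /= tnth_mktuple.
apply/measurable_fun_pair.
- apply: (measurableT_comp measurable_fst); exact: measurable_tnth.
- apply: (measurableT_comp measurable_snd); exact: measurable_tnth.
Qed.

HB.instance Definition _ (s : 'S_n) := isMeasurableFun.Build _ _ _ _
  (@permute_tuple U V n s) (measurable_permute_tuple s).

(** A permutation only reorders the factors c (C i), and the rectangles form a
    generating pi-system. *)
Lemma probability_permute_tuple (R : realType)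
    (nu : probability (n.-tuple (U * V)%type) R)
    (a : set U -> \bar R) (c : set V -> \bar R) :
  (forall A C, (forall i, measurable (A i)) -> (forall i, measurable (C i)) ->
     nu (pair_rect A C) = (\prod_(i < n) (a (A i) * c (C i)))%E) ->
  forall (s : 'S_n) D, measurable D -> nu (permute_tuple s @^-1` D) = nu D.
Proof.
move=> nu_rect s D mD.
rewrite -[LHS]/(pushforward nu (permute_tuple s) D).
have rectT : pair_rects [set: n.-tuple (U * V)].
  by exists (fun=> setT), (fun=> setT); split=> //; apply/seteqP; split=> z.
apply: (measure_unique pair_rects (fun=> setT)) => //.
- exact: measurable_pair_rectsE.
- exact: pair_rects_setI.
- by rewrite bigcup_const.
- move=> _ [A [C [mA mC ->]]].
  rewrite -[LHS]/(nu (permute_tuple s @^-1` pair_rect A C)).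
  rewrite preimage_permute_rect [RHS](nu_rect _ _ mA mC).
  rewrite nu_rect => [||i]//; last exact: mC.
  rewrite !big_split /=; congr (_ * _)%E.
  by rewrite [RHS](reindex_inj (@perm_inj _ s^-1%g)).
- move=> _; rewrite -[X in (X < _)%E]/(nu (permute_tuple s @^-1` setT)).
  by rewrite preimage_setT -ge0_fin_numE// fin_num_measure.
Qed.

End pair_rect_measurable.

Section density_product.
Local Open Scope ereal_scope.
Context d1 d2 (U : measurableType d1) (V : measurableType d2) (R : realType).
Context (m1 : {sigma_finite_measure set U -> \bar R}).
Context (m2 : {sigma_finite_measure set V -> \bar R}).
Context (f1 : U -> R) (f2 : V -> R).
Hypotheses (mf1 : measurable_fun setT f1) (mf2 : measurable_fun setT f2).
Hypothesis f1_ge0 : forall x, (0 <= f1 x)%R.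
Hypothesis f2_ge0 : forall y, (0 <= f2 y)%R.

Lemma integral_tensor A C : measurable A -> measurable C ->
  \int[m1 \x m2]_(z in A `*` C) (tensor f1 f2 z)%:E =
  (\int[m1]_(x in A) (f1 x)%:E) * (\int[m2]_(y in C) (f2 y)%:E).
Proof.
move=> mA mC; pose g1 := (EFin \o f1) \_ A; pose g2 := (EFin \o f2) \_ C.
have mg1 : measurable_fun setT g1.
  apply/(measurable_restrictT _ _).1 => //; apply: measurable_funTS.
  exact/measurable_EFinP.
have mg2 : measurable_fun setT g2.
  apply/(measurable_restrictT _ _).1 => //; apply: measurable_funTS.
  exact/measurable_EFinP.
have g1_ge0 x : 0 <= g1 x by apply: erestrict_ge0 => y _; rewrite lee_fin.
have g2_ge0 y : 0 <= g2 y by apply: erestrict_ge0 => x _; rewrite lee_fin.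
rewrite integral_mkcond [in RHS]integral_mkcond [X in _ * X]integral_mkcond.
have -> : (fun z => (tensor f1 f2 z)%:E) \_ (A `*` C) =
    (fun z => g1 z.1 * g2 z.2).
  apply/funext => -[x y]; rewrite /g1 /g2 !patchE in_setX /=.
  by case: (x \in A); case: (y \in C); rewrite /= ?mul0e ?mule0 // EFinM.
rewrite fubini_tonelli1 => [||z]; last 2 first.
- apply: emeasurable_funM.
  + by apply: (measurableT_comp mg1); exact: measurable_fst.
  + by apply: (measurableT_comp mg2); exact: measurable_snd.
- exact: mule_ge0.
rewrite -ge0_integralZr//; last exact: integral_ge0.
by apply: eq_integral => x _; rewrite /fubini_F /= ge0_integralZl.
Qed.

End density_product.

Section joint_law.
Context d (T : measurableType d) (R : realType) (P : probability T R).
Context d' (U : measurableType d') (n : nat) (X : 'I_n -> {RV P >-> U}).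

Lemma measurable_joint : measurable_fun setT (joint (fun i => X i : T -> U)).
Proof.
apply/measurable_fun_tnthP => i.
by rewrite (_ : _ \o _ = X i)//; apply/funext => w; rewrite /= tnth_mktuple.
Qed.

HB.instance Definition _ := isMeasurableFun.Build _ _ _ _
  (joint (fun i => X i : T -> U)) measurable_joint.

Definition joint_RV : {RV P >-> n.-tuple U} := joint (fun i => X i : T -> U).

Lemma probability_joint_box (A : 'I_n -> set U) :
  mutually_independent P (fun i => X i : T -> U) ->
  (forall i, measurable (A i)) ->
  P (joint (fun i => X i : T -> U) @^-1` [set z | forall i, A i (tnth z i)]) =
  (\prod_(i < n) P (X i @^-1` A i))%E.
Proof.
move=> indepX mA.
have := indepX [set: 'I_n]%SET A (fun i _ => mA i).
rewrite [RHS](eq_bigl xpredT) => [<-|i]; last by rewrite finset.in_setT.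
congr (P _); apply/seteqP; split=> w /= wA i.
  by move=> _; have := wA i; rewrite tnth_mktuple.
by rewrite tnth_mktuple; apply: wA; rewrite /= finset.in_setT.
Qed.

End joint_law.

(** On a rectangle, independence of the observations factors the law over the
    indices, and the tensor form of the density factors each term over the two
    components. *)
Lemma iid_tensor_permute d1 d2 (U : measurableType d1) (V : measurableType d2)
    (R : realType) (m1 : {sigma_finite_measure set U -> \bar R})
    (m2 : {sigma_finite_measure set V -> \bar R}) (f1 : U -> R) (f2 : V -> R)
    d (T : measurableType d) (P : probability T R) n
    (Z : 'I_n -> {RV P >-> (U * V)%type}) :
  is_density m1 f1 -> is_density m2 f2 ->
  (forall i, has_density (m1 \x m2)%E (tensor f1 f2) (Z i)) ->
  mutually_independent P (fun i => Z i : T -> _) ->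
  forall (s : 'S_n) D, measurable D ->
    distribution P (joint_RV Z) (permute_tuple s @^-1` D) =
    distribution P (joint_RV Z) D.
Proof.
move=> [mf1 f1_ge0 _] [mf2 f2_ge0 _] Z_density Z_indep.
apply: (@probability_permute_tuple _ _ _ _ _ _ (distribution P (joint_RV Z))
  (fun A => \int[m1]_(x in A) (f1 x)%:E)%E
  (fun C => \int[m2]_(y in C) (f2 y)%:E)%E) => A C mA mC.
rewrite -[LHS]/(P (joint (fun i => Z i : T -> _) @^-1` _)).
rewrite (probability_joint_box Z_indep (A := fun i => A i `*` C i)).
  apply: eq_bigr => i _.
  rewrite -[LHS]/(distribution P (Z i) _) Z_density ?integral_tensor//.
  exact: measurableX.
by move=> i; exact: measurableX.
Qed.

(** * The permuted test *)

Section hsic_measurable.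
Context {R : realType} {p q n : nat}.

Lemma measurable_sum_cond d (T : measurableType d) (I : Type) (s : seq I)
    (Q : pred I) (h : I -> T -> R) :
  (forall i, measurable_fun setT (h i)) ->
  measurable_fun setT (fun x => \sum_(i <- s | Q i) h i x).
Proof.
move=> mh; under eq_fun do rewrite big_mkcond /=.
by apply: measurable_sum => i; case: (Q i).
Qed.

Lemma measurable_gauss_kernel d (T : measurableType d) m (lam : m.-tuple R)
    (f g : T -> m.-tuple R) :
  measurable_fun setT f -> measurable_fun setT g ->
  measurable_fun setT (fun x => gauss_kernel lam (f x) (g x)).
Proof.
move=> /measurable_fun_tnthP mf /measurable_fun_tnthP mg.
apply: measurable_prod => i _; apply: measurable_funM => //.
apply: measurableT_comp => //; apply: measurableT_comp => //.
apply: measurable_funM => //; apply: measurable_funX.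
under eq_fun do rewrite tnth_mktuple.
by apply: measurable_funB; [exact: mf|exact: mg].
Qed.

Lemma measurable_hsic (lam : p.-tuple R) (mu : q.-tuple R) :
  measurable_fun setT
    (fun z : n.-tuple (p.-tuple R * q.-tuple R)%type => hsic lam mu (tnth z)).
Proof.
have mk i j : measurable_fun setT
    (fun z : n.-tuple (p.-tuple R * q.-tuple R)%type =>
       gauss_kernel lam (tnth z i).1 (tnth z j).1).
  by apply: measurable_gauss_kernel; apply: (measurableT_comp measurable_fst);
    exact: measurable_tnth.
have ml i j : measurable_fun setT
    (fun z : n.-tuple (p.-tuple R * q.-tuple R)%type =>
       gauss_kernel mu (tnth z i).2 (tnth z j).2).
  by apply: measurable_gauss_kernel; apply: (measurableT_comp measurable_snd);
    exact: measurable_tnth.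
apply: measurable_funB; [apply: measurable_funD|apply: measurable_funM => //];
  apply: measurable_funM => //;
  repeat (apply: measurable_sum_cond => ?); exact: measurable_funM.
Qed.

End hsic_measurable.

Lemma permute_sample1 (R : realType) p q n
    (z : 'I_n -> p.-tuple R * q.-tuple R) :
  permute_sample z 1%g = z.
Proof. by apply/funext => i; rewrite /permute_sample perm1; case: (z i). Qed.

Lemma hsic_permute_tuple (R : realType) p q n (lam : p.-tuple R)
    (mu : q.-tuple R) (s : 'S_n) (z : n.-tuple (p.-tuple R * q.-tuple R)) :
  hsic lam mu (tnth (permute_tuple s z)) =
  hsic lam mu (permute_sample (tnth z) s).
Proof. by congr hsic; apply/funext => i; rewrite tnth_mktuple. Qed.

(** The unpermuted statistic is the one of the identity permutation, at index
    [None]. *)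
Lemma perm_test_eq1 (R : realType) p q n (alpha : R) (lam : p.-tuple R)
    (mu : q.-tuple R) B (tau : 'I_B -> 'S_n)
    (z : n.-tuple (p.-tuple R * q.-tuple R)) (k : nat) :
  `|Num.ceil (B.+1%:R * (1 - alpha))|%N = k -> (0 < k <= B.+1)%N ->
  (perm_test alpha lam mu tau (tnth z) == 1%N) =
  (k <= num_below (fun o => hsic lam mu
          (tnth (permute_tuple (oapp tau 1%g o) z))) None)%N.
Proof.
move=> kE k01; set h := (h in num_below h).
have hE o : h o = hsic lam mu (permute_sample (tnth z) (oapp tau 1%g o)).
  exact: hsic_permute_tuple.
have hs : h None = hsic lam mu (tnth z) by rewrite hE permute_sample1.
have valuesE : hsic_values lam mu tau (tnth z) =
    map h (rcons [seq Some b | b <- enum 'I_B] None).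
  rewrite map_rcons -map_comp hs; congr rcons.
  by apply: eq_map => b; rewrite /= hE.
have enumE : perm_eq (rcons [seq Some b | b <- enum 'I_B] None)
    (index_enum (option 'I_B)).
  apply: uniq_perm; first 1 last.
  - exact: index_enum_uniq.
  - move=> -[b|]; rewrite mem_rcons inE mem_index_enum //=.
    by rewrite mem_map ?mem_enum // => ? ? [].
  - rewrite rcons_uniq map_inj_uniq ?enum_uniq ?andbT; last by move=> ? ? [].
    by apply/mapP => -[].
rewrite /perm_test /perm_quantile kE order_stat_lt; last first.
  by rewrite size_rcons size_map size_enum_ord.
rewrite valuesE count_map (seq.permP enumE) /num_below -sum1_card sum1_count hs.
by case: (k <= _)%N.
Qed.

Lemma ceil_rank (R : realType) (B : nat) (alpha : R) : 0 < alpha < 1 ->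
  let k := `|Num.ceil (B.+1%:R * (1 - alpha))|%N in
  (0 < k <= B.+1)%N /\ (B.+1 - k)%:R <= B.+1%:R * alpha.
Proof.
move=> /andP[a0 a1] k.
have x0 : 0 < B.+1%:R * (1 - alpha) by rewrite mulr_gt0// subr_gt0.
have kE : (k : int) = Num.ceil (B.+1%:R * (1 - alpha)).
  by rewrite /k gez0_abs// ceil_ge0 (lt_trans _ x0)// ltrN10.
have xk : B.+1%:R * (1 - alpha) <= k%:R.
  by have := ceil_ge (B.+1%:R * (1 - alpha)); rewrite -kE.
have kB : (k <= B.+1)%N.
  rewrite -lez_nat kE ceil_le_int -[leRHS]mulr1 ler_pM2l// lerBlDr lerDl.
  exact: ltW.
split; first by rewrite kB -(ltr_nat R) (lt_le_trans x0).
by rewrite natrB// lerBlDr -lerBlDl -[X in X - _]mulr1 -mulrBr.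
Qed.

Lemma probability_joint_perm d (T : measurableType d) (R : realType)
    (P : probability T R) n B (tau : 'I_B -> {RV P >-> 'S_n})
    (t : B.-tuple 'S_n) :
  (forall b, uniform_perm (tau b)) ->
  mutually_independent P (fun b => tau b : T -> _) ->
  P (joint (fun b => tau b : T -> _) @^-1` [set t]) = ((n`! ^ B)%:R^-1)%:E.
Proof.
move=> unif indep.
rewrite set1_tuple_box.
rewrite (probability_joint_box indep (A := fun b => [set tnth t b])) //.
rewrite (eq_bigr (fun=> ((n`!)%:R^-1)%:E)); last by move=> b _; exact: unif.
by rewrite prodEFin prodr_const card_ord natrX exprVn.
Qed.

(** Condition on the value t of the random permutations: each value has
    probability (n!)^-B and leaves a fixed region for W. *)
Lemma probability_uniform_perms d (T : measurableType d) (R : realType)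
    (P : probability T R) n B (tau : 'I_B -> {RV P >-> 'S_n})
    d' (S : measurableType d') (W : {RV P >-> S})
    (rej : ('I_B -> 'S_n) -> set S) :
  (forall b, uniform_perm (tau b)) ->
  mutually_independent P (fun b => tau b : T -> _) ->
  independent P (joint (fun b => tau b : T -> _)) (W : T -> S) ->
  (forall t, measurable (rej t)) ->
  P [set w | rej (fun b => tau b w) (W w)] =
  (((n`! ^ B)%:R^-1 *
    \sum_(t : {ffun 'I_B -> 'S_n}) fine (distribution P W (rej t)))%R)%:E.
Proof.
move=> tau_uniform tau_indep tau_W_indep mrej.
pose J := joint (fun b : 'I_B => tau b : T -> _).
(* on each slice the permutations are constant, so independence splits its
   probability into a uniform factor and a probability on W only *)
pose slice (t : {ffun 'I_B -> 'S_n}) :=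
  J @^-1` [set [tuple t b | b < B]] `&` W @^-1` rej t.
have mset1 (t : B.-tuple 'S_n) : measurable [set t].
  rewrite set1_tuple_box.
  exact: (measurable_tuple_box (A := fun b => [set tnth t b])).
have mWrej t : measurable (W @^-1` rej t).
  by rewrite -[X in measurable X]setTI; exact: measurable_funPT.
have mslice t : measurable (slice t).
  apply: measurableI => //.
  by rewrite -[X in measurable X]setTI; exact: measurable_joint.
have eventE : [set w | rej (fun b => tau b w) (W w)] =
    \bigcup_(t in [set` index_enum {ffun 'I_B -> 'S_n}]) slice t.
  apply/seteqP; split=> w /= => [rejw|[t _ [Jt wt]]].
    exists [ffun b => tau b w]; first exact: mem_index_enum.
    split; first by apply: eq_mktuple => b; rewrite ffunE.
    rewrite /= (_ : fun_of_fin _ = (fun b => tau b w))//.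
    by apply/funext => b; rewrite ffunE.
  rewrite (_ : (fun b => tau b w) = t)//; apply/funext => b.
  by have := congr1 (fun z => tnth z b) Jt; rewrite !tnth_mktuple.
have Pslice t :
    P (slice t) = ((n`! ^ B)%:R^-1 * fine (distribution P W (rej t)))%:E.
  rewrite -[distribution P W _]/(P (W @^-1` _)).
  rewrite tau_W_indep// (probability_joint_perm _ tau_uniform tau_indep).
  by rewrite EFinM fineK ?fin_num_measure.
rewrite eventE measure_fin_bigcup//; last first.
  move=> s t _ _ [w [[Js _] [Jt _]]]; apply/ffunP => b.
  have := congr1 (fun z => tnth z b) (etrans (esym Js) Jt).
  by rewrite !tnth_mktuple.
rewrite -fsbig_seq ?index_enum_uniq// (eq_bigr _ (fun t _ => Pslice t)).
by rewrite sumEFin -mulr_sumr.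
Qed.

(** The average over t given by [probability_uniform_perms] is the sum bounded
    in [randomization_bound], the factor (n!)^B being the number of values of
    the permutations. *)
Lemma permutation_test_level d1 d2 (U : measurableType d1)
    (V : measurableType d2) (R : realType)
    (m1 : {sigma_finite_measure set U -> \bar R})
    (m2 : {sigma_finite_measure set V -> \bar R}) (f1 : U -> R) (f2 : V -> R)
    d (T : measurableType d) (P : probability T R) n
    (Z : 'I_n -> {RV P >-> (U * V)%type})
    B (tau : 'I_B -> {RV P >-> 'S_n})
    (H : n.-tuple (U * V) -> R) (k : nat) :
  is_density m1 f1 -> is_density m2 f2 ->
  (forall i, has_density (m1 \x m2)%E (tensor f1 f2) (Z i)) ->
  mutually_independent P (fun i => Z i : T -> _) ->
  (forall b, uniform_perm (tau b)) ->
  mutually_independent P (fun b => tau b : T -> _) ->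
  independent P (joint (fun b => tau b : T -> _))
    (joint (fun i => Z i : T -> _)) ->
  measurable_fun setT H ->
  (P [set w | (k <= num_below (fun o => H (permute_tuple
                 (oapp (fun b => tau b w) 1%g o) (joint_RV Z w))) None)%N] <=
   ((B.+1 - k)%:R / B.+1%:R)%:E)%E.
Proof.
move=> f1_density f2_density Z_density Z_indep tau_uniform tau_indep.
move=> tau_Z_indep mH.
pose rej (t : 'I_B -> 'S_n) :=
  reject (@permute_tuple U V n) H k (oapp t 1%g) None.
have mrej t : measurable (rej t).
  by apply: measurable_reject => //; exact: measurable_permute_tuple.
rewrite -[X in P X]/[set w | rej (fun b => tau b w) (joint_RV Z w)].
rewrite (probability_uniform_perms tau_uniform tau_indep
  (W := joint_RV Z) tau_Z_indep mrej) lee_fin.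
have := randomization_bound (@permute_tupleM U V n)
  (@measurable_permute_tuple _ _ U V n)
  (iid_tensor_permute f1_density f2_density Z_density Z_indep) mH 'I_B k.
rewrite card_ord card_Sn => bound.
rewrite mulrC ler_pdivrMr ?ltr0n ?expn_gt0 ?fact_gt0//.
rewrite mulrAC ler_pdivlMr ?ltr0n// mulrC.
exact: bound.
Qed.

Theorem proposition1 (R : realType) (p q n : nat)
    (p_ge1 : (1 <= p)%N) (q_ge1 : (1 <= q)%N) (n_ge4 : (4 <= n)%N)
    (alpha : R) (alpha01 : 0 < alpha < 1)
    (lam : p.-tuple R) (lam_gt0 : forall i : 'I_p, 0 < tnth lam i)
    (mu : q.-tuple R) (mu_gt0 : forall j : 'I_q, 0 < tnth mu j)
    (B : nat)
    (f1 : p.-tuple R -> R) (f1_density : is_density (lebesgue_tuple p) f1)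
    (f2 : q.-tuple R -> R) (f2_density : is_density (lebesgue_tuple q) f2)
    (d : measure_display) (T : measurableType d) (P : probability T R)
    (Z : 'I_n -> {RV P >-> (p.-tuple R * q.-tuple R)%type})
    (Z_density : forall i : 'I_n,
      has_density (lebesgue_tuple p \x lebesgue_tuple q)%E
        (tensor f1 f2) (Z i))
    (Z_indep : mutually_independent P (fun i : 'I_n => Z i : T -> _))
    (tau : 'I_B -> {RV P >-> 'S_n})
    (tau_uniform : forall b : 'I_B, uniform_perm (tau b))
    (tau_indep : mutually_independent P (fun b : 'I_B => tau b : T -> _))
    (tau_Z_indep : independent P
      (joint (fun b : 'I_B => tau b : T -> _))
      (joint (fun i : 'I_n => Z i : T -> _))) :
  (P [set w | perm_test alpha lam mu
                (fun b : 'I_B => tau b w) (fun i : 'I_n => Z i w) = 1%N]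
   <= alpha%:E)%E.
Proof.
have [] := ceil_rank B alpha01.
move kE : `|_|%N => k k_range k_alpha.
have := permutation_test_level k f1_density f2_density Z_density Z_indep
  tau_uniform tau_indep tau_Z_indep (measurable_hsic lam mu).
move=> /(@le_trans _ _ _ _ alpha%:E); rewrite lee_fin.
rewrite ler_pdivrMr ?ltr0n// [alpha * _]mulrC => /(_ k_alpha).
congr (is_true (P _ <= _)%E); apply/funext => w; rewrite /mkset.
rewrite -(perm_test_eq1 lam mu (fun b => tau b w) (joint_RV Z w) kE k_range).
rewrite (_ : tnth (joint_RV Z w) = (fun i => Z i w)); last first.
  by apply/funext => i; rewrite tnth_mktuple.
by apply/propext; apply: iff_sym; exact: (rwP eqP).
Qed.
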